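(* Let $n\ge 3$ and let $F_n^1$ be the complex $n$-dimensional Leibniz algebra with basis $\{x_1,\dots,x_n\}$ and multiplication $[x_i,x_1]=x_{i+1}$ for $2\le i\le n-1$ (all other products of basis elements are zero). The classes $\overline{\psi_2}$, $\overline{\xi_1}$, $\overline{\xi_2}$, $\overline{\varphi_{1,2}}$, $\overline{\varphi_{n,k}}$ ($2\le k\le n$) and $\overline{\psi_j}$ ($4\le j\le n$) form a basis of $HL^2(F_n^1,F_n^1)$. Consequently, $\dim HL^2(F_n^1,F_n^1)=2n$.
   Context: A Leibniz algebra over $\mathbb{C}$ is a vector space $L$ with a bilinear bracket satisfying $[x,[y,z]]=[[x,y],z]-[[x,z],y]$. $ZL^2(L,L)$ is the space of $2$-cocycles: bilinear maps $\varphi:L\times L\to L$ with $[x,\varphi(y,z)]-[\varphi(x,y),z]+[\varphi(x,z),y]+\varphi(x,[y,z])-\varphi([x,y],z)+\varphi([x,z],y)=0$ for all $x,y,z$. $BL^2(L,L)$ is the subspace of $2$-coboundaries: maps $f(x,y)=[d(x),y]+[x,d(y)]-d([x,y])$ with $d:L\to L$ linear. $HL^2(L,L)=ZL^2(L,L)/BL^2(L,L)$, and $\overline{\varphi}$ denotes the class of a cocycle $\varphi$. The cocycles of $F_n^1$ used here are the bilinear maps with the following nonzero values on pairs of basis elements (all values not listed are zero): $\varphi_{j,k}(x_j,x_1)=x_k$ for $1\le j\le n$, $2\le k\le n$; for $2\le j\le n$, $\psi_j(x_i,x_2)=x_{j+i-2}$ for $2\le i\le n-j+2$; $\xi_1(x_1,x_2)=x_1$,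 $\xi_1(x_i,x_2)=(i-2)x_i$ for $3\le i\le n$, $\xi_1(x_i,x_3)=-x_{i+1}$ for $2\le i\le n-1$; $\xi_2(x_1,x_2)=x_n$. *)

(* Defs.v *)
From HB Require Import structures.
From mathcomp Require Import all_boot all_order all_algebra.
From mathcomp Require Import ring.
From mathcomp Require Import reals complex.

Set Implicit Arguments.
Unset Strict Implicit.
Unset Printing Implicit Defensive.

Import GRing.Theory.
Local Open Scope ring_scope.
Local Open Scope quotient_scope.

(** Quotient V / U of a finite-dimensional vector space.  The additive group
    is MathComp's quotient by a subgroup; the scaling and the finite-dimensional
    structure are added here. *)
Section QuotientSpace.
Variables (K : fieldType) (V : vectType K) (U : {vspace V}).

Let Uzmod : zmodClosed V := GRing.ZmodClosed.clone V (pred_of_vspace U) _.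

Definition quotv : Type := Quotient.quot Uzmod.

HB.instance Definition _ := GRing.Zmodule.on quotv.
HB.instance Definition _ := EqQuotient.on quotv.

Definition piv (v : V) : quotv := \pi_quotv v.

Lemma piv_eq v w : (piv v == piv w) = (v - w \in U).
Proof. by rewrite [RHS](Quotient.idealrBE Uzmod). Qed.

Lemma pivK (x : quotv) : piv (repr x) = x.
Proof. exact: reprK. Qed.

Lemma pivD v w : piv (v + w) = piv v + piv w.
Proof. exact: (raddfD (\pi_(Quotient.quot Uzmod))). Qed.

Lemma reprvK v : repr (piv v) - v \in U.
Proof. by rewrite -piv_eq pivK. Qed.

Definition scalev (a : K) (x : quotv) : quotv := piv (a *: repr x).

Lemma scalev_pi a v : scalev a (piv v) = piv (a *: v).
Proof. by apply/eqP; rewrite piv_eq -scalerBr memvZ // reprvK. Qed.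

Lemma scalevA a b x : scalev a (scalev b x) = scalev (a * b) x.
Proof. by rewrite -[x]pivK !scalev_pi scalerA. Qed.
Lemma scalev1 : left_id 1 scalev.
Proof. by move=> x; rewrite -[x]pivK scalev_pi scale1r. Qed.
Lemma scalevDr : right_distributive scalev +%R.
Proof. by move=> a x y; rewrite -[x]pivK -[y]pivK -pivD !scalev_pi -pivD scalerDr. Qed.
Lemma scalevDl x : {morph scalev^~ x : a b / a + b}.
Proof. by move=> a b; rewrite -[x]pivK !scalev_pi -pivD scalerDl. Qed.

HB.instance Definition _ :=
  GRing.Zmodule_isLmodule.Build K quotv scalevA scalev1 scalevDr scalevDl.

Lemma piv_is_linear : linear piv.
Proof. by move=> a v w; rewrite pivD -scalev_pi. Qed.

HB.instance Definition _ := GRing.isSemilinear.Build K V quotv _ piv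
  (GRing.semilinear_linear piv_is_linear).

Lemma piv_eq0 v : (piv v == 0) = (v \in U).
Proof. by rewrite -(linear0 piv) piv_eq subr0. Qed.

(* The vectors v - projv U v represent V / U canonically. *)
Lemma quotv_vect_iso : vector_axiom_def (\dim (U^C)) quotv.
Proof.
pose p v := v - projv U v.
have pC v : p v \in (U^C)%VS.
  by rewrite -lker_proj memv_ker linearB /= [projv U (projv _ _)]projv_id ?memv_proj // subrr.
have pL : linear p.
  by move=> a v w; rewrite /p linearP /= scalerBr opprD addrACA.
pose pl : {linear V -> V} := HB.pack p (GRing.isSemilinear.Build _ _ _ _ p
  (GRing.semilinear_linear pL)).
have pU v : (v \in U) -> p v = 0 by move=> Uv; rewrite /p projv_id ?subrr.
have p_pi v : p (repr (piv v)) = p v.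
  apply/eqP; rewrite -subr_eq0; apply/eqP.
  by rewrite -(linearB pl) /= pU // reprvK.
have piv_p v : piv (p v) = piv v.
  by apply/eqP; rewrite piv_eq /p addrAC subrr add0r rpredN memv_proj.
pose b := vbasis (U^C)%VS.
have bb : basis_of (U^C)%VS b := vbasisP _.
exists (fun x => \row_i coord b i (p (repr x))).
  move=> a x y; apply/rowP=> i; rewrite !mxE -[x]pivK -[y]pivK.
  by rewrite -linearP !p_pi pL linearP.
exists (fun r : 'rV_(\dim (U^C)) => piv (\sum_i r 0 i *: b`_i)).
  move=> x /=; under eq_bigr do rewrite mxE.
  by rewrite -(coord_basis bb (pC _)) piv_p pivK.
move=> r; apply/rowP=> i; rewrite mxE p_pi.
set s := \sum_i _.
have sC : s \in (U^C)%VS.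
  by apply: rpred_sum => j _; rewrite memvZ // vbasis_mem // mem_nth // size_tuple.
have -> : p s = s.
  by rewrite /p; have := sC; rewrite -lker_proj memv_ker => /eqP ->; rewrite subr0.
by rewrite coord_sum_free // (basis_free bb).
Qed.

HB.instance Definition _ := Lmodule_hasFinDim.Build K quotv quotv_vect_iso.

End QuotientSpace.

(** Leibniz cohomology in degree 2.  A bilinear map L x L -> L is an element of
    'Hom(L, 'Hom(L, L)), so that [phi x y] is its value at (x, y). *)
Notation bilmap L := 'Hom(L, 'Hom(L, L)).

Section LeibnizCohomology.
Variables (K : fieldType) (L : vectType K).
Implicit Types (mu phi : bilmap L) (d : 'End(L)).

Definition leibniz mu : Prop := forall x y z,
  mu x (mu y z) = mu (mu x y) z - mu (mu x z) y.

Variable mu : bilmap L.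

Definition cocycle_defect (x y z : L) phi : L :=
  mu x (phi y z) - mu (phi x y) z + mu (phi x z) y
  + phi x (mu y z) - phi (mu x y) z + phi (mu x z) y.

Definition coboundary d : bilmap L :=
  linfun (fun x => mu (d x) + (mu x \o d) - (d \o mu x))%VF.

(* Cut out by the basis triples only, in order to get a {vspace _}; ZL2P below
   is the usual description by all triples. *)
Definition ZL2 : {vspace bilmap L} :=
  let e := vbasis {:L} in
  (\bigcap_(i < \dim {:L}) \bigcap_(j < \dim {:L}) \bigcap_(k < \dim {:L})
     lker (linfun (cocycle_defect e`_i e`_j e`_k)))%VS.

Definition BL2 : {vspace bilmap L} := limg (linfun coboundary).

(* The divisor is the preimage of BL2 by the inclusion of ZL2. *)
Definition HL2 : vectType K :=
  quotv (linfun (vsval : subvs_of ZL2 -> bilmap L) @^-1: BL2)%VS.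

(* vsproj inverts the inclusion of ZL2; HL2class phi is meaningless when phi
   is not in ZL2. *)
Definition HL2class phi : HL2 := piv _ (vsproj ZL2 phi).

Let lincombD (W : lmodType K) (a : K) (s t s' t' : W) :
  (a *: s + t) + (a *: s' + t') = a *: (s + s') + (t + t').
Proof. by rewrite addrACA -scalerDr. Qed.

Let lincombN (W : lmodType K) (a : K) (s t : W) :
  - (a *: s + t) = a *: (- s) + (- t).
Proof. by rewrite opprD scalerN. Qed.

Fact defect_is_linear x y z : linear (cocycle_defect x y z).
Proof.
move=> a f g; rewrite /cocycle_defect.
have lE u v : (a *: f + g) u v = a *: f u v + g u v.
  by rewrite add_lfunE scale_lfunE add_lfunE scale_lfunE.
have lE' u v : mu (a *: f u v + g u v) = a *: mu (f u v) + mu (g u v).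
  by rewrite linearP.
rewrite !lE !lE' linearP /= !(add_lfunE, scale_lfunE).
by rewrite !lincombN !lincombD.
Qed.

Fact coboundary_subproof d : linear (fun x =>
  mu (d x) + (mu x \o d) - (d \o mu x))%VF.
Proof.
move=> a x y; apply/lfunP=> z.
rewrite !linearP /= !(add_lfunE, scale_lfunE, opp_lfunE, comp_lfunE) /=.
by rewrite !linearP /= ?lincombN !lincombD.
Qed.

Lemma coboundaryE d x y :
  coboundary d x y = mu (d x) y + mu x (d y) - d (mu x y).
Proof.
pose h : {linear L -> 'End(L)} := HB.pack (fun x =>
  mu (d x) + (mu x \o d) - (d \o mu x))%VF
  (GRing.isSemilinear.Build _ _ _ _ _ (GRing.semilinear_linear (coboundary_subproof d))).
by rewrite (lfunE h) /= !(add_lfunE, opp_lfunE, comp_lfunE).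
Qed.

Fact coboundary_is_linear : linear coboundary.
Proof.
move=> a d d'; apply/lfunP=> x; apply/lfunP=> y.
rewrite !(add_lfunE, scale_lfunE, coboundaryE) linearP /=.
rewrite !(add_lfunE, scale_lfunE) linearP /=.
by rewrite ?lincombN !lincombD.
Qed.

Lemma BL2P (f : bilmap L) : reflect
  (exists d : 'End(L), forall x y, f x y = mu (d x) y + mu x (d y) - d (mu x y))
  (f \in BL2).
Proof.
pose h : {linear 'End(L) -> bilmap L} := HB.pack coboundary
  (GRing.isSemilinear.Build _ _ _ _ _ (GRing.semilinear_linear coboundary_is_linear)).
apply: (iffP memv_imgP) => [[d _ ->] | [d fE]]; exists d.
- by move=> x y; rewrite (lfunE h) coboundaryE.
- exact: memvf.
by rewrite (lfunE h); apply/lfunP=> x; apply/lfunP=> y; rewrite fE coboundaryE.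
Qed.

Lemma ZL2P phi : reflect
  (forall x y z, mu x (phi y z) - mu (phi x y) z + mu (phi x z) y
     + phi x (mu y z) - phi (mu x y) z + phi (mu x z) y = 0)
  (phi \in ZL2).
Proof.
pose h x y z : {linear bilmap L -> L} := HB.pack (cocycle_defect x y z)
  (GRing.isSemilinear.Build _ _ _ _ _ (GRing.semilinear_linear (defect_is_linear x y z))).
have kerE x y z :
    (phi \in lker (linfun (cocycle_defect x y z))) = (cocycle_defect x y z phi == 0).
  by rewrite memv_ker (lfunE (h x y z)).
have capP (V : vectType K) n (U : 'I_n -> {vspace V}) v :
    reflect (forall i, v \in U i) (v \in \bigcap_i U i)%VS.
  apply: (iffP idP) => [vU i | vU].
    by apply: (subvP (bigcapv_inf i isT (subvv (U i)))) vU.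
  by rewrite memvE; apply/subv_bigcapP => i _; rewrite -memvE.
apply: (iffP idP) => [/capP phiZ | phiZ]; last first.
  apply/capP=> i; apply/capP=> j; apply/capP=> k; rewrite kerE.
  by apply/eqP; apply: phiZ.
pose D x y z := cocycle_defect x y z phi.
have vanish (f : L -> L) : linear f ->
    (forall i : 'I_(\dim {:L}), f (vbasis {:L})`_i = 0) -> forall v, f v = 0.
  move=> fL f0 v.
  pose g : {linear L -> L} := HB.pack f
    (GRing.isSemilinear.Build _ _ _ _ _ (GRing.semilinear_linear fL)).
  rewrite (coord_vbasis (memvf v)) -[f]/(g : L -> L) linear_sum big1 // => i _.
  by rewrite linearZ /= f0 scaler0.
have linx y z : linear (fun x => D x y z).
  move=> a x x'; rewrite /D /cocycle_defect.
  do 3!rewrite ?linearP /= ?add_lfunE ?scale_lfunE.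
  by rewrite ?lincombN !lincombD.
have liny x z : linear (fun y => D x y z).
  move=> a y y'; rewrite /D /cocycle_defect.
  do 3!rewrite ?linearP /= ?add_lfunE ?scale_lfunE.
  by rewrite ?lincombN !lincombD.
have linz x y : linear (D x y).
  move=> a z z'; rewrite /D /cocycle_defect.
  do 3!rewrite ?linearP /= ?add_lfunE ?scale_lfunE.
  by rewrite ?lincombN !lincombD.
move=> x y z; apply: (vanish _ (linz x y)) => k.
apply: (vanish _ (liny x _) _ y) => j.
apply: (vanish _ (linx _ _) _ x) => i.
by move/capP/(_ j)/capP/(_ k): (phiZ i); rewrite kerE => /eqP.
Qed.

Import VectorInternalTheory.

Lemma BL2_sub_ZL2 : leibniz mu -> (BL2 <= ZL2)%VS.
Proof.
move=> lmu; apply/subvP=> f /BL2P[d fE]; apply/ZL2P=> x y z; rewrite !fE.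
rewrite !(linearB, linearD) /= !(add_lfunE, opp_lfunE) !lmu !(linearB, linearD) /=.
apply: v2r_inj; apply/rowP=> i; rewrite !(linearB, linearD, linear0) /= !linearN /= !mxE.
ring.
Qed.

Lemma HL2class_eq phi phi' : phi \in ZL2 -> phi' \in ZL2 ->
  (HL2class phi == HL2class phi') = (phi - phi' \in BL2).
Proof.
move=> Zphi Zphi'; rewrite piv_eq -memv_preim lfunE /=.
by rewrite !vsprojK.
Qed.
End LeibnizCohomology.

(** The algebra F_n^1 on the space 'rV_n, and its cocycles.
    Basis vectors are numbered from 1: [ebas K n i] is x_i for 1 <= i <= n, and 0
    otherwise.  In [psi] the natural-number subtractions are exact for
    2 <= j <= n. *)
Section AlgebraF1.
Variables (K : fieldType) (n : nat).
Local Notation V := 'rV[K]_n.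

Definition ebas (i : nat) : V := \row_(k < n) (k.+1 == i)%:R.
Local Notation x := ebas.

(* The bilinear map whose value at (x_i, x_j) is t i j, for 1 <= i, j <= n. *)
Definition bilmap_of (t : nat -> nat -> V) : bilmap V :=
  linfun (fun u : V => linfun (fun v : V =>
    \sum_(i < n) \sum_(j < n) (u 0 i * v 0 j) *: t i.+1 j.+1)).

Definition F1 : bilmap V := bilmap_of (fun i j =>
  if (2 <= i <= n.-1)%N && (j == 1)%N then x i.+1 else 0).

Definition phi (j k : nat) : bilmap V := bilmap_of (fun i l =>
  if (i == j)%N && (l == 1)%N then x k else 0).

Definition psi (j : nat) : bilmap V := bilmap_of (fun i l =>
  if (2 <= i <= n - j + 2)%N && (l == 2)%N then x (j + i - 2)%N else 0).

Definition xi1 : bilmap V := bilmap_of (fun i l =>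
  if (i == 1)%N && (l == 2)%N then x 1%N
  else if (3 <= i <= n)%N && (l == 2)%N then (i - 2)%N%:R *: x i
  else if (2 <= i <= n.-1)%N && (l == 3)%N then - x i.+1
  else 0).

Definition xi2 : bilmap V := bilmap_of (fun i l =>
  if (i == 1)%N && (l == 2)%N then x n else 0).

Fact bilmap_of_subproof1 (t : nat -> nat -> V) (u : V) : linear (fun v : V =>
  \sum_(i < n) \sum_(j < n) (u 0 i * v 0 j) *: t i.+1 j.+1 : V).
Proof.
move=> a v w; rewrite scaler_sumr -big_split; apply: eq_bigr => i _ /=.
rewrite scaler_sumr -big_split; apply: eq_bigr => j _ /=.
by rewrite !mxE mulrDr scalerDl scalerA mulrCA.
Qed.

Let lf1 (t : nat -> nat -> V) (u : V) : {linear V -> V} := HB.pack (fun v : V =>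
    \sum_(i < n) \sum_(j < n) (u 0 i * v 0 j) *: t i.+1 j.+1 : V)
  (GRing.isSemilinear.Build _ _ _ _ _
     (GRing.semilinear_linear (bilmap_of_subproof1 t u))).

Fact bilmap_of_subproof2 (t : nat -> nat -> V) : linear (fun u : V => linfun (lf1 t u)).
Proof.
move=> a u w; apply/lfunP=> v; rewrite !(add_lfunE, scale_lfunE) !lfunE /=.
rewrite scaler_sumr -big_split; apply: eq_bigr => i _ /=.
rewrite scaler_sumr -big_split; apply: eq_bigr => j _ /=.
by rewrite !mxE mulrDl scalerDl scalerA mulrA.
Qed.

Lemma bilmap_ofE t u v : bilmap_of t u v =
  \sum_(i < n) \sum_(j < n) (u 0 i * v 0 j) *: t i.+1 j.+1.
Proof.
pose h : {linear V -> 'End(V)} := HB.pack (fun u : V => linfun (lf1 t u))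
  (GRing.isSemilinear.Build _ _ _ _ _
     (GRing.semilinear_linear (bilmap_of_subproof2 t))).
by rewrite (lfunE h) /= (lfunE (lf1 t u)).
Qed.

Lemma bilmap_of_basis t i j : (1 <= i <= n)%N -> (1 <= j <= n)%N ->
  bilmap_of t (x i) (x j) = t i j.
Proof.
case: i => [|p] //= ltpn; case: j => [|q] //= ltqn; rewrite bilmap_ofE.
pose i0 := Ordinal ltpn; pose j0 := Ordinal ltqn.
rewrite (bigD1 i0) //= (bigD1 j0) //= !mxE !eqxx mulr1 scale1r.
have eqE (k l : 'I_n) : k != l -> (k.+1 == l.+1)%N = false.
  by move=> nkl; rewrite eqSS (inj_eq val_inj) (negPf nkl).
rewrite !big1 ?addr0 // => [k nk | k nk]; last first.
  by rewrite !mxE (eqE _ j0 nk) mulr0 scale0r.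
by rewrite big1 // => l _; rewrite !mxE (eqE _ i0 nk) mul0r scale0r.
Qed.

Lemma F1_leibniz : leibniz F1.
Proof.
pose c (v : V) : K := \sum_(j < n) v 0 j * (j == 0 :> nat)%:R.
pose S (u : V) : V := \sum_(i < n) u 0 i *: (if (2 <= i.+1 <= n.-1)%N then x i.+2 else 0).
have F1E u v : F1 u v = c v *: S u.
  rewrite /F1 bilmap_ofE /c /S scaler_sumr; apply: eq_bigr => i _.
  rewrite scaler_suml; apply: eq_bigr => j _ /=.
  rewrite eqSS; case: (1 < i.+1 <= n.-1)%N; case: (j == 0 :> nat) => /=;
    by rewrite ?scaler0 ?mulr1 ?mulr0 ?scale0r ?scalerA // mulrC.
have SZ a u : S (a *: u) = a *: S u.
  by rewrite /S scaler_sumr; apply: eq_bigr => i _; rewrite mxE scalerA.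
have cZ a v : c (a *: v) = a * c v.
  by rewrite /c mulr_sumr; apply: eq_bigr => j _; rewrite mxE mulrA.
have cS u : c (S u) = 0.
  rewrite /c big1 // => j _; case: eqP => j0; last by rewrite mulr0.
  rewrite mulr1 /S summxE big1 // => i _; rewrite mxE.
  by case: ifP; rewrite mxE ?mulr0 // eqSS j0 mulr0.
move=> u v w; rewrite !F1E !SZ !cZ cS mulr0 scale0r !scalerA.
by rewrite mulrC subrr.
Qed.
End AlgebraF1.

(* Main.v *)
From HB Require Import structures.
Require Import Defs.
From mathcomp Require Import all_boot all_order all_algebra.
From mathcomp Require Import reals complex zify ring.

(** Write N for the right multiplication by x_1 in F_n^1 and c for the
    x_1-coordinate, so that [u, v] = c(v) N u.  The operator N shifts
    x_2, ..., x_n and kills x_1 and x_n; in particular c N = 0.  A bilinear map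
    f amounts to the operators f_p = f(-, x_p), and the cocycle condition on
    basis triples (lemma [ZL2_F1P]) turns into
      c(f_1 x_1) = 0,   c(f_q x_p) = 0               for p, q >= 2,
      N f_p - f_p N = - c(f_p x_1) N                 for p >= 2,
      f_{p+1} = - (c(f_p x_1) + c(f_1 x_p)) N        for p >= 2 (with f_{n+1} = 0).
    Hence a cocycle is determined by f_1, which is almost arbitrary, and f_2,
    which almost commutes with N.  The coboundary of d has the components
      f_1 = N d - d N + c(d x_1) N   and   f_p = c(d x_p) N for p >= 2.

    Spanning.  One can choose d x_1, d x_2, d x_3, ... one after the other so
    that subtracting the coboundary of d makes f_1 vanish at x_2, ..., x_{n-1}
    and leaves only a multiple of x_2 at x_1 and a vector of <x_2, ..., x_n>
    at x_n: the obstructions are combinations of phi_{1,2} and the phi_{n,k}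
    ([cocycle_normalize]).  Once f_1 = 0, all f_p with p >= 4 vanish and f_2
    is, up to a multiple of the particular solution xi_1, an operator commuting
    with N with values in the kernel of c; such operators are generated by xi_2
    and by the powers of N on <x_2, ..., x_n>, which are the psi_j
    ([cocycle_vanishing_at_x1]).  Among these only psi_3, that is f_2 = N, is a
    coboundary ([psi3_coboundary]).

    Independence ([basic_indep]).  If a combination of the listed cocycles is the
    coboundary of d, its values at (x_1, x_2), (x_2, x_2) and (x_1, x_1) give
    directly the coefficients of xi_1, xi_2, of the psi_j and of phi_{1,2},
    because the coboundary takes the value 0, a multiple of x_3, and a vector
    in the image of N, respectively.  Its values at (x_i, x_1) for 2 <= i < n
    force d x_m = N^{m-2} d x_2 + (m-2) c(d x_1) x_m for 2 <= m <= n, whence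
    N d x_n = 0 by nilpotency.  This is its value at (x_n, x_1), namely the
    combination of the x_k whose coefficients are those of the phi_{n,k}. *)

Set Implicit Arguments.
Unset Strict Implicit.
Unset Printing Implicit Defensive.

Import GRing.Theory.
Local Open Scope ring_scope.

(** * Bases of the second cohomology space *)

Section HL2Basis.
Variables (K : fieldType) (L : vectType K) (mu : bilmap L).

Lemma HL2class_linear : linear (HL2class mu).
Proof. by move=> a f g; rewrite /HL2class !linearP. Qed.

HB.instance Definition _ := GRing.isSemilinear.Build K _ _ _ (HL2class mu)
  (GRing.semilinear_linear HL2class_linear).

Lemma HL2class_eq0 f : f \in ZL2 mu -> (HL2class mu f == 0) = (f \in BL2 mu).
Proof.
move=> Zf; have := HL2class_eq Zf (mem0v _).
by rewrite subr0 linear0.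
Qed.

Lemma coboundary_BL2 d : coboundary mu d \in BL2 mu.
Proof. by apply/BL2P; exists d => x y; rewrite coboundaryE. Qed.

(** Independence is asked in terms of a coefficient function on indices, in the
    form in which it can be cut along the concatenation that defines the list
    of cocycles. *)
Lemma HL2_basis (s : seq (bilmap L)) :
    leibniz mu -> {subset s <= ZL2 mu} -> (ZL2 mu <= <<s>> + BL2 mu)%VS ->
    (forall k : nat -> K, \sum_(0 <= i < size s) k i *: s`_i \in BL2 mu ->
       forall i, (i < size s)%N -> k i = 0) ->
  basis_of {: HL2 mu}%VS [seq HL2class mu f | f <- s].
Proof.
move=> lmu sZ Zs indep; rewrite /basis_of eqEsubv subvf /=; apply/andP; split.
  apply/subvP=> h _.
  have -> : h = HL2class mu (vsval (repr h)) by rewrite /HL2class vsvalK pivK.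
  have /memv_addP[u us [b bB ->]] := subvP Zs _ (subvsP (repr h)).
  rewrite linearD /=; have /eqP -> : HL2class mu b == 0.
    by rewrite HL2class_eq0 // (subvP (BL2_sub_ZL2 lmu)).
  have := memv_img (linfun (HL2class mu)) us.
  rewrite limg_span lfunE addr0 /=.
  by congr (_ \in <<_>>%VS); apply: eq_map => f; rewrite lfunE.
pose X := in_tuple [seq HL2class mu f | f <- s].
apply/(@freeP _ _ _ X) => k.
(* Coefficients on ordinals, extended by 0 to all indices. *)
pose k' i := if insub i is Some j then k j else 0.
have kk' i : k i = k' i by rewrite /k' valK.
move=> sum0 i; rewrite kk'; apply: indep; last by rewrite -[size s](size_map (HL2class mu)).
rewrite -HL2class_eq0; last first.
  by rewrite big_mkord rpred_sum // => j _; rewrite memvZ ?sZ ?mem_nth.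
rewrite linear_sum -[X in _ == X]sum0 -[size s](size_map (HL2class mu)) big_mkord.
apply/eqP; apply: eq_bigr => j _.
by rewrite linearZ /= (nth_map 0) // -?kk' // -[size s](size_map (HL2class mu)).
Qed.
End HL2Basis.

(** * Linear combinations along lists *)

Section SumSeq.
Variables (K : nzRingType) (W : lmodType K).

Lemma sum_scale_cat (k : nat -> K) (s1 s2 : seq W) :
  \sum_(0 <= i < size (s1 ++ s2)) k i *: (s1 ++ s2)`_i =
  \sum_(0 <= i < size s1) k i *: s1`_i
  + \sum_(0 <= i < size s2) k (i + size s1)%N *: s2`_i.
Proof.
rewrite size_cat (big_cat_nat (n := size s1)) ?leq_addr //=; congr (_ + _).
  by apply: eq_big_nat => i /andP[_ lti]; rewrite nth_cat lti.
rewrite -{1}[size s1]add0n big_addn addnC addnK; apply: eq_bigr => i _.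
by rewrite nth_cat ltnNge leq_addl /= addnK.
Qed.

Lemma sum_scale_map_iota (k : nat -> K) (g : nat -> W) a b :
  let s := [seq g i | i <- index_iota a b] in
  \sum_(0 <= i < size s) k i *: s`_i = \sum_(a <= j < b) k (j - a)%N *: g j.
Proof.
rewrite /= size_map size_iota -{3}[a]add0n big_addn; apply: eq_big_nat => i /andP[_ lti].
by rewrite addnK (nth_map 0%N) ?size_iota // nth_iota // addnC.
Qed.

Lemma sum_nat_lt4 (G : nat -> W) : \sum_(0 <= i < 4) G i = G 0%N + G 1%N + G 2%N + G 3%N.
Proof. by rewrite !big_nat_recr ?big_geq //= add0r. Qed.

End SumSeq.

(** * Coordinates and maps given on the basis *)

Section Coordinates.
Variables (K : fieldType) (n : nat).
Local Notation V := 'rV[K]_n.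
Local Notation x := (ebas K n).

Lemma ebas_out i : ~~ (1 <= i <= n)%N -> x i = 0.
Proof.
move=> iout; apply/rowP=> k; rewrite !mxE; case: eqP => // ki.
by have := ltn_ord k; lia.
Qed.

(** The index is a natural number numbered from 1, as for [ebas]; coordinates
    out of range are 0.  The codomain is K^o so that linear map lemmas apply. *)
Definition coor (i : nat) (v : V) : K^o := \sum_(k < n) v 0 k * (k.+1 == i)%:R.

Lemma coor_is_linear i : linear (coor i).
Proof.
move=> a u v; rewrite /coor scaler_sumr -big_split; apply: eq_bigr => k _ /=.
by rewrite !mxE mulrDl -mulrA.
Qed.

HB.instance Definition _ i := GRing.isSemilinear.Build K V K^o _ (coor i)
  (GRing.semilinear_linear (coor_is_linear i)).

Lemma coor_ord (v : V) (k : 'I_n) : coor k.+1 v = v 0 k.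
Proof.
rewrite /coor (bigD1 k) //= eqxx mulr1 big1 ?addr0 // => l lk.
by rewrite eqSS (negPf lk : (l == k :> nat) = false) mulr0.
Qed.

Lemma coor_out i v : ~~ (1 <= i <= n)%N -> coor i v = 0.
Proof.
move=> iout; rewrite /coor big1 // => k _; case: eqP => [ki|]; last by rewrite mulr0.
by have := ltn_ord k; lia.
Qed.

Lemma coor_ebas i j : coor i (x j) = ((i == j) && (1 <= i <= n)%N)%:R.
Proof.
have [|iout] := boolP (1 <= i <= n)%N; last by rewrite coor_out // andbF.
case: i => // k lt_kn; rewrite (coor_ord _ (Ordinal lt_kn)) mxE /=.
by rewrite andbT.
Qed.

Lemma coorP (u v : V) :
  (forall i, (1 <= i <= n)%N -> coor i u = coor i v) -> u = v.
Proof. by move=> uv; apply/rowP=> k; rewrite -!coor_ord uv //=. Qed.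

Lemma sum_coor v : v = \sum_(1 <= i < n.+1) coor i v *: x i.
Proof.
apply: coorP => i lei; rewrite linear_sum /= (bigD1_seq i) ?iota_uniq ?mem_index_iota //=.
rewrite linearZ /= coor_ebas eqxx lei /= [_ *: _]mulr1 big1 ?addr0 // => j ji.
by rewrite linearZ /= coor_ebas eq_sym (negPf ji) scaler0.
Qed.

Lemma sum_coor_ker1 v : coor 1 v = 0 -> v = \sum_(2 <= i < n.+1) coor i v *: x i.
Proof.
move=> v1; have [n0|n_gt0] := posnP n.
  by apply: coorP => i; lia.
by rewrite {1}[v]sum_coor big_ltn // v1 scale0r add0r.
Qed.

Lemma lin_ebas0 (W : lmodType K) (f : V -> W) : linear f ->
  (forall i, (1 <= i <= n)%N -> f (x i) = 0) -> forall v, f v = 0.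
Proof.
move=> fL f0 v.
pose g : {linear V -> W} := HB.pack f
  (GRing.isSemilinear.Build _ _ _ _ _ (GRing.semilinear_linear fL)).
rewrite -[f]/(g : V -> W) [v]sum_coor linear_sum big_nat big1 // => i lei.
by rewrite linearZ /= f0 ?scaler0.
Qed.

Lemma bilmapP (f g : bilmap V) :
  (forall i j, (1 <= i <= n)%N -> (1 <= j <= n)%N -> f (x i) (x j) = g (x i) (x j)) ->
  f = g.
Proof.
move=> fg; apply/subr0_eq/lfunP=> u; rewrite zero_lfunE; move: u.
apply: lin_ebas0 => [|i lei]; first exact: linearP.
apply/lfunP=> v; rewrite zero_lfunE; move: v.
apply: lin_ebas0 => [|j lej]; first exact: linearP.
by rewrite add_lfunE opp_lfunE add_lfunE opp_lfunE fg // subrr.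
Qed.

Lemma ZL2_ebasP (mu f : bilmap V) :
  (forall i j k, (1 <= i <= n)%N -> (1 <= j <= n)%N -> (1 <= k <= n)%N ->
     cocycle_defect mu (x i) (x j) (x k) f = 0) -> f \in ZL2 mu.
Proof.
move=> f0; apply/ZL2P.
suff: forall u v w, cocycle_defect mu u v w f = 0 by [].
have rearr (W : lmodType K) (a : K) (s t s' t' : W) :
  (a *: s + t) + (a *: s' + t') = a *: (s + s') + (t + t').
  by rewrite addrACA -scalerDr.
have rearrN (W : lmodType K) (a : K) (s t : W) :
  - (a *: s + t) = a *: (- s) + (- t) by rewrite opprD scalerN.
move=> u v w; move: u; apply: lin_ebas0 => [a u u'|i lei].
  by rewrite /cocycle_defect; do 3!rewrite ?linearP /= ?add_lfunE ?scale_lfunE;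
     rewrite ?rearrN !rearr.
move: v; apply: lin_ebas0 => [a u u'|j lej].
  by rewrite /cocycle_defect; do 3!rewrite ?linearP /= ?add_lfunE ?scale_lfunE;
     rewrite ?rearrN !rearr.
move: w; apply: lin_ebas0 => [a u u'|k lek]; last exact: f0.
by rewrite /cocycle_defect; do 3!rewrite ?linearP /= ?add_lfunE ?scale_lfunE;
   rewrite ?rearrN !rearr.
Qed.

(** A table that vanishes out of range gives the values at all indices, since
    basis vectors out of range are 0: this is what allows x_{n+1} = 0 to absorb
    the boundary cases below. *)
Lemma bilmap_of_ebas (t : nat -> nat -> V) i j :
  (~~ ((1 <= i <= n) && (1 <= j <= n))%N -> t i j = 0) ->
  bilmap_of t (x i) (x j) = t i j.
Proof.
move=> t0; have [/andP[lei lej]|out] := boolP ((1 <= i <= n) && (1 <= j <= n))%N.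
  exact: bilmap_of_basis.
rewrite t0 //; move: out; rewrite negb_and => /orP[] /ebas_out ->.
  by rewrite linear0 zero_lfunE.
by rewrite linear0.
Qed.

Lemma exists_linmap (t : nat -> V) :
  exists d : 'End(V), forall i, (1 <= i <= n)%N -> d (x i) = t i.
Proof.
exists (bilmap_of (fun _ => t) (x 1)) => i lei.
by rewrite bilmap_of_basis //; lia.
Qed.

End Coordinates.

(** * The algebra and the listed cocycles *)

Section AlgebraF1.
Variables (K : fieldType) (n : nat).
Hypothesis n_ge3 : (3 <= n)%N.
Local Notation V := 'rV[K]_n.
Local Notation x := (ebas K n).
Local Notation F := (F1 K n).

(** No upper bound on i: the product x_n x_1 is x_{n+1} = 0. *)
Lemma F1_ebas i j : F (x i) (x j) = if (2 <= i)%N && (j == 1)%N then x i.+1 else 0.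
Proof.
rewrite /F1 bilmap_of_ebas => [|out]; last by case: ifP => //; lia.
case: ifP => c1; case: ifP => c2 //; last 1 first; try lia.
by rewrite ebas_out //; lia.
Qed.

(** No upper bound on i: past i = n - j + 2 the value is a basis vector out of
    range. *)
Lemma psi_ebas j i l : (2 <= j)%N ->
  psi K n j (x i) (x l) = if (2 <= i)%N && (l == 2)%N then x (j + i - 2)%N else 0.
Proof.
move=> j2; rewrite /psi bilmap_of_ebas => [|out]; last first.
  by case: ifP => // ?; rewrite ebas_out //; lia.
case: ifP => c1; case: ifP => c2 //; try lia.
by rewrite ebas_out //; lia.
Qed.

Lemma xi1_ebas i l : xi1 K n (x i) (x l) =
  if (i == 1)%N && (l == 2)%N then x 1
  else if (2 <= i)%N && (l == 2)%N then (i - 2)%:R *: x i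
  else if (2 <= i)%N && (l == 3)%N then - x i.+1 else 0.
Proof.
rewrite /xi1 bilmap_of_ebas => [|out]; last first.
  do 3!(case: ifP => ?; first by [rewrite ebas_out ?scaler0 ?oppr0 //; lia | lia]).
  by [].
case: ifP => // c1; case: ifP => c2.
  by rewrite ifT //; lia.
case: ifP => c3.
  rewrite ifF ?ifT //; lia.
case: ifP => c4.
  have [->|i2] := eqVneq i 2; first by rewrite subnn scale0r.
  by rewrite ebas_out ?scaler0 //; lia.
case: ifP => c5 //.
by rewrite ebas_out ?oppr0 //; lia.
Qed.

Lemma xi2_ebas i l : xi2 K n (x i) (x l) =
  if (i == 1)%N && (l == 2)%N then x n else 0.
Proof. by rewrite /xi2 bilmap_of_ebas // => out; case: ifP => // ?; lia. Qed.

Lemma phi_ebas j k i l : (1 <= j <= n)%N -> phi K n j k (x i) (x l) =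
  if (i == j)%N && (l == 1)%N then x k else 0.
Proof. by move=> lej; rewrite /phi bilmap_of_ebas // => out; case: ifP => // ?; lia. Qed.

Definition shift (u : V) : V := F u (x 1).

Lemma shift_is_linear : linear shift.
Proof. by move=> a u v; rewrite /shift linearP /= add_lfunE scale_lfunE. Qed.

HB.instance Definition _ := GRing.isSemilinear.Build K V V _ shift
  (GRing.semilinear_linear shift_is_linear).

Lemma shift_ebas i : shift (x i) = if (2 <= i)%N then x i.+1 else 0.
Proof. by rewrite /shift F1_ebas andbT. Qed.

Lemma F1E u v : F u v = coor 1 v *: shift u.
Proof.
apply/eqP; rewrite -subr_eq0; apply/eqP; move: v; apply: lin_ebas0 => [a v w|j lej].
  by rewrite !linearP /= scalerDl scalerBr -!scalerA opprD addrACA.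
move: u; apply: lin_ebas0 => [a v w|i lei].
  by rewrite !linearP /= !add_lfunE !scale_lfunE [in RHS]scalerDr addrACA.
rewrite F1_ebas shift_ebas coor_ebas (eq_sym 1%N).
case: (j =P 1%N) => /= [_|_]; last by rewrite andbF scale0r subrr.
by rewrite andbT (leq_trans _ n_ge3) // scale1r subrr.
Qed.

Lemma coor_shift i u : coor i.+1 (shift u) = if (2 <= i < n)%N then coor i u else 0.
Proof.
apply/eqP; rewrite -subr_eq0; apply/eqP; move: u; apply: lin_ebas0 => [a v w|j lej].
  by case: ifP => _; rewrite !linearP /= ?subr0 // [in RHS]scalerDr addrACA.
have -> : (if (2 <= i < n)%N then coor i (x j) else 0) =
          ((i == j) && (2 <= i < n)%N)%:R.
  by rewrite coor_ebas; case: ifP => ?; rewrite ?andbF // andbT; congr (_%:R); lia.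
rewrite shift_ebas; case: ifP => j2; rewrite ?linear0 ?coor_ebas; last first.
  by rewrite (_ : _ && _ = false) ?subr0 //; lia.
by apply/eqP; rewrite subr_eq0; apply/eqP; congr (_%:R); lia.
Qed.

Lemma F1_right u q : F u (x q) = if q == 1%N then shift u else 0.
Proof.
rewrite F1E // coor_ebas (eq_sym 1%N); case: (q =P 1%N) => [_|_]; last by rewrite scale0r.
by rewrite (leq_trans _ n_ge3) // scale1r.
Qed.

Lemma shift_ker u : coor 1 u = 0 -> shift u = 0 -> u = coor n u *: x n.
Proof.
move=> u1 Nu; apply: coorP => i lei; rewrite linearZ /= coor_ebas lei andbT.
have [->|ni] := eqVneq i n; first by rewrite [_ *: _]mulr1.
rewrite scaler0; have [->//|i1] := eqVneq i 1%N.
by have := coor_shift i u; rewrite Nu linear0 ifT //; lia.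
Qed.

(** The preimage can be taken without x_1-coordinate because the shift kills x_1;
    with this choice of d x_1, the term c(d x_1) N of a coboundary is absent. *)
Lemma shift_surj w : coor 1 w = 0 -> coor 2 w = 0 ->
  exists2 w', coor 1 w' = 0 & shift w' = w.
Proof.
move=> w1 w2; exists (\sum_(2 <= i < n) coor i.+1 w *: x i).
  rewrite linear_sum big_nat big1 // => i lei.
  by rewrite linearZ /= coor_ebas (_ : _ && _ = false) ?scaler0 //; lia.
apply: coorP => -[//|i] lei; rewrite coor_shift //.
have [lei'|] := boolP (2 <= i < n)%N; last first.
  by move=> nlei; have [->|->] : i = 0%N \/ i = 1%N by lia.
rewrite linear_sum /= (bigD1_seq i) ?iota_uniq ?mem_index_iota //=.
rewrite linearZ /= coor_ebas eqxx (_ : (_ <= _ <= _)%N) /=; last by lia.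
rewrite [_ *: _]mulr1 big1 ?addr0 // => j ji.
by rewrite linearZ /= coor_ebas eq_sym (negPf ji) scaler0.
Qed.

Local Notation N := shift.

(** * Cocycles *)

(** Only products by x_1 survive, so the six terms of the defect collapse
    according to whether p or q is 1. *)
Lemma defect_ebas f u p q : cocycle_defect F u (x p) (x q) f =
  coor 1 (f (x p) (x q)) *: N u
  + (if q == 1%N then f u (N (x p)) + f (N u) (x p)
                      - N (f u (x p)) else 0)
  + (if p == 1%N then N (f u (x q)) - f (N u) (x q) else 0).
Proof.
rewrite /cocycle_defect F1E !F1_right.
have [q1|q1] := eqVneq q 1%N; have [p1|p1] := eqVneq p 1%N => /=;
  rewrite ?andbF ?andbT ?linear0 /= ?zero_lfunE ?(addr0, subr0, add0r, oppr0, sub0r).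
all: by apply/rowP=> k; rewrite !mxE; ring.
Qed.

(** The triples (x_i, x_1, x_p) give the commutation of f(-, x_p) with the shift,
    and (x_i, x_p, x_1) give the fourth condition after this commutation is
    substituted.  The first two conditions come from triples starting with x_2,
    whose shift x_3 is nonzero because 3 <= n. *)
Lemma ZL2_F1P (f : bilmap V) : reflect
  [/\ coor 1 (f (x 1) (x 1)) = 0,
      forall p q, (2 <= p)%N -> (2 <= q)%N -> coor 1 (f (x p) (x q)) = 0,
      forall p i, (2 <= p)%N ->
        N (f (x i) (x p)) = f (N (x i)) (x p) - coor 1 (f (x 1) (x p)) *: N (x i)
    & forall p i, (2 <= p)%N -> f (x i) (x p.+1) =
        - (coor 1 (f (x 1) (x p)) + coor 1 (f (x p) (x 1))) *: N (x i)]
  (f \in ZL2 F).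
Proof.
have N1 : N (x 1) = 0 by rewrite shift_ebas.
have ne1 p : (2 <= p)%N -> (p == 1)%N = false by case: p => [|[|]].
have Np p : (2 <= p)%N -> N (x p) = x p.+1 by move=> p2; rewrite shift_ebas // p2.
apply: (iffP idP) => [/ZL2P fZ | [f1 f2 f3 f4]].
  have {}fZ u p q : cocycle_defect F u (x p) (x q) f = 0 by exact: fZ.
  have coor0 a : a *: N (x 2) = 0 -> a = 0.
    move/(congr1 (coor 3)); rewrite linear0 linearZ /= Np // coor_ebas n_ge3.
    by rewrite [_ *: _]mulr1.
  have f3 p i : (2 <= p)%N ->
      N (f (x i) (x p)) = f (N (x i)) (x p) - coor 1 (f (x 1) (x p)) *: N (x i).
    move=> p2; have := fZ (x i) 1%N p; rewrite defect_ebas ne1 // eqxx addr0.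
    by move/eqP; rewrite addrC addr_eq0 subr_eq addrC => /eqP ->.
  split=> // [|p q p2 q2|p i p2].
  - apply: coor0; have := fZ (x 2) 1%N 1%N; rewrite defect_ebas !eqxx N1 linear0 add0r.
    by move=> <-; apply/rowP=> k; rewrite !mxE; ring.
  - by apply: coor0; have := fZ (x 2) p q; rewrite defect_ebas !ne1 // !addr0.
  - have := fZ (x i) p 1%N; rewrite defect_ebas eqxx (ne1 p p2) addr0 (Np p p2) (f3 p i p2).
    move=> e; apply/eqP; rewrite -subr_eq0 -[X in _ == X]e; apply/eqP.
    by apply/rowP=> k; rewrite !mxE; ring.
apply: ZL2_ebasP => i p q /andP[i1 _] /andP[p1 _] /andP[q1 _]; rewrite defect_ebas.
have [->|p2] : p = 1%N \/ (2 <= p)%N by lia.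
  have [->|q2] : q = 1%N \/ (2 <= q)%N by lia.
    rewrite !eqxx N1 f1 linear0; apply/rowP=> k; rewrite !mxE; ring.
  rewrite (ne1 q q2) eqxx (f3 q i q2); apply/rowP=> k; rewrite !mxE; ring.
rewrite (ne1 p p2).
have [->|q2] : q = 1%N \/ (2 <= q)%N by lia.
  rewrite eqxx (Np p p2) (f3 p i p2) (f4 p i p2); apply/rowP=> k; rewrite !mxE; ring.
by rewrite (ne1 q q2) f2 // scale0r !addr0.
Qed.

Lemma phi_cocycle j k : (1 <= j <= n)%N -> (2 <= k)%N -> phi K n j k \in ZL2 F.
Proof.
move=> lej k2.
have ne1 p : (2 <= p)%N -> (p == 1)%N = false by case: p => [|[|]].
have phi0 p u : (2 <= p)%N -> phi K n j k u (x p) = 0.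
  move=> p2; move: u; apply: lin_ebas0 => [a u v|i lei].
    by rewrite !linearP /= add_lfunE scale_lfunE.
  by rewrite phi_ebas // ne1 // andbF.
have c1 i p : coor 1 (phi K n j k (x i) (x p)) = 0.
  rewrite phi_ebas //; case: ifP => _; rewrite ?linear0 // coor_ebas.
  by rewrite eq_sym ne1.
apply/ZL2_F1P; split=> // p i p2; first by rewrite !phi0 // !linear0 scale0r subr0.
by rewrite !c1 phi0 ?leqW // addr0 oppr0 scale0r.
Qed.

Lemma psi_cocycle j : (2 <= j <= n)%N -> psi K n j \in ZL2 F.
Proof.
move=> /andP[j2 jn].
have ne1 p : (2 <= p)%N -> (p == 1)%N = false by case: p => [|[|]].
have c1 i p : coor 1 (psi K n j (x i) (x p)) = 0.
  rewrite psi_ebas //; case: ifP => ?; rewrite ?linear0 // coor_ebas.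
  by rewrite eq_sym ne1 //; lia.
apply/ZL2_F1P; split=> // p i p2.
  rewrite c1 scale0r subr0 !shift_ebas psi_ebas //.
  case: (leqP 2 i) => i2; last by rewrite /= !linear0 zero_lfunE.
  rewrite /= psi_ebas // ltnS (ltnW i2) /=; case: ifP => _; last by rewrite linear0.
  by rewrite shift_ebas ifT; [congr (x _); lia | lia].
by rewrite !c1 psi_ebas // addr0 oppr0 scale0r eqSS ne1 // andbF.
Qed.

Lemma xi2_cocycle : xi2 K n \in ZL2 F.
Proof.
have c1 i p : coor 1 (xi2 K n (x i) (x p)) = 0.
  rewrite xi2_ebas; case: ifP => ?; rewrite ?linear0 // coor_ebas.
  by rewrite (_ : _ && _ = false) //; lia.
apply/ZL2_F1P; split=> // p i p2.
  rewrite c1 scale0r subr0 !shift_ebas xi2_ebas.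
  have -> : xi2 K n (if (1 < i)%N then x i.+1 else 0) (x p) = 0.
    case: ifP => i2; last by rewrite linear0 zero_lfunE.
    by rewrite xi2_ebas ifF //; lia.
  case: ifP => _; rewrite ?linear0 // shift_ebas ifT; last by lia.
  by rewrite ebas_out //; lia.
by rewrite !c1 xi2_ebas addr0 oppr0 scale0r ifF //; lia.
Qed.

Lemma xi1_cocycle : xi1 K n \in ZL2 F.
Proof.
have c1 i p : (1 < n)%N -> coor 1 (xi1 K n (x i) (x p)) = ((i == 1) && (p == 2))%N%:R.
  move=> n1; rewrite xi1_ebas; case: ifP => c1.
    by rewrite coor_ebas; congr (_%:R); lia.
  do 2?[case: ifP => ?]; rewrite ?linear0 ?linearN ?linearZ //= coor_ebas.
    by rewrite (_ : _ && _ = false) ?scaler0 //; lia.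
  by rewrite (_ : _ && _ = false) ?oppr0 //; lia.
have {}c1 := fun i p => c1 i p (ltnW n_ge3).
apply/ZL2_F1P; split=> [|p q p2 q2|p i p2|p i p2].
- by rewrite c1.
- by rewrite c1 (_ : _ && _ = false) //; lia.
- rewrite c1 eqxx /= shift_ebas.
  have [i2|i2] := ltnP 1 i; last first.
    rewrite linear0 zero_lfunE scaler0 subr0 xi1_ebas.
    case: ifP => // _; first by rewrite shift_ebas.
    by rewrite !ifF ?linear0 //; lia.
  have i1 : (i == 1)%N = false by lia.
  have i1' : (i.+1 == 1)%N = false by lia.
  rewrite !xi1_ebas i1 i1' i2 ltnS (ltnW i2) /=.
  have [_|p3] := eqVneq p 2%N => /=.
    rewrite linearZ /= shift_ebas i2 (_ : i.+1 - 2 = (i - 2).+1)%N; last by lia.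
    by rewrite -natr1 scalerDl scale1r addrK.
  rewrite scale0r subr0; case: ifP => _; rewrite ?linear0 //.
  by rewrite linearN /= shift_ebas ifT //; lia.
- rewrite !c1 xi1_ebas shift_ebas !eqSS.
  have -> : (p == 1)%N = false by lia.
  rewrite ?andbF addr0 /=; have [_|p3] := eqVneq p 2%N; rewrite ?andbT ?andbF /=.
    by case: ifP => _; rewrite ?scaler0 // scaleN1r.
  by rewrite oppr0 scale0r.
Qed.

(** * Coboundaries and normal forms *)

Lemma coboundary_F1 d u j : coboundary F d u (x j) =
  (if j == 1%N then N (d u) - d (N u) else 0) + coor 1 (d (x j)) *: N u.
Proof.
rewrite coboundaryE !F1_right (F1E u); case: ifP => _.
  by rewrite addrAC.
by rewrite linear0 subr0.
Qed.

(** psi_3 restricts to N on the component x_2, hence it is the coboundary of the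
    map sending x_2 to x_1 and the other basis vectors to 0: both N d and d N
    vanish, because N kills x_1 and x_2 is not hit by N. *)
Lemma psi3_coboundary : psi K n 3 \in BL2 F.
Proof.
have [d dE] := @exists_linmap K n (fun i => if i == 2%N then x 1 else 0).
have {}dE i : d (x i) = if i == 2%N then x 1 else 0.
  have [/dE //|out] := boolP (1 <= i <= n)%N; rewrite ebas_out // linear0 ifF //; lia.
suff -> : psi K n 3 = coboundary F d by exact: coboundary_BL2.
apply: bilmapP => i j _ _; rewrite psi_ebas // coboundary_F1 !dE.
have -> : N (if i == 2%N then x 1 else 0) = 0.
  by case: ifP => _; rewrite ?linear0 // shift_ebas.
have -> : d (N (x i)) = 0.
  rewrite shift_ebas //; case: ifP => i2; last by rewrite linear0.
  by rewrite dE ifF //; lia.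
rewrite subr0 if_same add0r shift_ebas //.
case: (j == 2)%N; last by rewrite andbF linear0 scale0r.
by rewrite coor_ebas (leq_trans _ n_ge3) // scale1r andbT.
Qed.

Lemma sum_phi_ebas v i l :
  (\sum_(2 <= k < n.+1) v k *: phi K n n k) (x i) (x l) =
  if (i == n)%N && (l == 1)%N then \sum_(2 <= k < n.+1) v k *: x k else 0.
Proof.
rewrite !sum_lfunE; case: ifP => c; [apply: eq_bigr | apply: big1] => k _;
  by rewrite !scale_lfunE phi_ebas ?c ?scaler0 //; lia.
Qed.

Lemma sum_psi_ebas m q i l : (2 <= m)%N ->
  (\sum_(m <= j < n.+1) q j *: psi K n j) (x i) (x l) =
  if (2 <= i)%N && (l == 2)%N then \sum_(m <= j < n.+1) q j *: x (j + i - 2)%N else 0.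
Proof.
move=> m2; rewrite !sum_lfunE !big_nat.
case: ifP => c; [apply: eq_bigr | apply: big1] => j lej;
  by rewrite !scale_lfunE psi_ebas ?c ?scaler0 //; lia.
Qed.

(** At x_1, the coboundary of d takes values in the image of the shift, which
    misses x_2: hence phi_{1,2}.  At x_i with 2 <= i < n, the value of d at
    x_{i+1} is still free and absorbs f(x_i, x_1).  At x_n no freedom is left,
    and the remainder is a combination of the phi_{n,k} because f(x_n, x_1) has
    no x_1-coordinate, as the fourth condition of [ZL2_F1P] for p = n shows. *)
Lemma cocycle_normalize f : f \in ZL2 F ->
  exists g a v, [/\ g \in BL2 F & forall i,
    (f - (g + a *: phi K n 1 2 + \sum_(2 <= k < n.+1) v k *: phi K n n k)) (x i) (x 1) = 0].
Proof.
move=> /ZL2_F1P[f1 f2 f3 f4].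
(* T m is the value of d at x_{m+2}: the recursion says that the coboundary
   of d agrees with f at (x_{m+2}, x_1) when m + 2 < n. *)
pose T := fix T m := if m is m'.+1 then N (T m') - f (x m'.+2) (x 1) else 0.
have N1 : N (x 1) = 0 by rewrite shift_ebas.
have fx1 p : (3 <= p)%N -> f (x 1) (x p) = 0.
  by case: p => // p p3; rewrite f4 // N1 scaler0.
have xS : x n.+1 = 0 by rewrite ebas_out ?ltnn ?andbF.
have fn1 : coor 1 (f (x n) (x 1)) = 0.
  have := f4 n 2%N (ltnW n_ge3); rewrite fx1 // linear0 add0r.
  rewrite xS linear0 shift_ebas // => /(congr1 (coor 3)).
  rewrite linear0 linearZ /= coor_ebas n_ge3 [_ *: _]mulr1 => /esym/eqP.
  by rewrite oppr_eq0 => /eqP.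
pose a := coor 2 (f (x 1) (x 1)).
have [w w1 Nw] : exists2 w, coor 1 w = 0 & N w = f (x 1) (x 1) - a *: x 2.
  apply: shift_surj => //; rewrite linearB linearZ /= coor_ebas.
    by rewrite f1 scaler0 subr0.
  by rewrite (ltnW n_ge3) [_ *: _]mulr1 subrr.
have [d dE] := @exists_linmap K n (fun i => if i == 1%N then w else T (i - 2)%N).
pose v k := coor k (f (x n) (x 1) - N (d (x n))).
exists (coboundary F d), a, v; split; first exact: coboundary_BL2.
suff vanish i : (1 <= i <= n)%N ->
  (f - (coboundary F d + a *: phi K n 1 2
        + \sum_(2 <= k < n.+1) v k *: phi K n n k)) (x i) (x 1) = 0.
  move=> i; have [/vanish //|/ebas_out ->] := boolP (1 <= i <= n)%N.
  by rewrite linear0 zero_lfunE.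
move=> lei.
rewrite !(add_lfunE, opp_lfunE, scale_lfunE) coboundary_F1 eqxx.
have d1 : d (x 1) = w by rewrite dE // (leq_trans _ n_ge3).
rewrite sum_phi_ebas andbT phi_ebas ?(leq_trans _ n_ge3) // andbT d1 w1 scale0r addr0.
have [->|i2] : i = 1%N \/ (2 <= i)%N by lia.
  rewrite d1 N1 linear0 subr0 Nw eqxx ifF; last by lia.
  by rewrite addr0 subrK subrr.
rewrite (_ : (i == 1)%N = false); last by lia.
rewrite scaler0 addr0 shift_ebas // i2.
have [->|ni] := eqVneq i n.
  rewrite xS linear0 subr0 -sum_coor_ker1.
    by rewrite addrCA subrr addr0 subrr.
  by rewrite linearB /= fn1 coor_shift // subr0.
rewrite !dE //; last by lia.
have -> : (i == 1)%N = false by lia.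
have -> : (i.+1 == 1)%N = false by lia.
case: i i2 {lei ni} => [|[|i]] // _; rewrite subSS !subSS !subn0 /=.
by apply/rowP=> k; rewrite !mxE; ring.
Qed.

(** Commutation with the shift, up to the multiple c(f(x_1, x_2)) of N which
    xi_1 compensates, determines f(-, x_2) by its values at x_1 and x_2: the
    former is in the kernel of N up to x_1, hence gives xi_1 and xi_2, and the
    coordinates of the latter are the coefficients of the psi_j. *)
Lemma cocycle_vanishing_at_x1 f : f \in ZL2 F -> (forall i, f (x i) (x 1) = 0) ->
  f = coor 1 (f (x 1) (x 2)) *: xi1 K n + coor n (f (x 1) (x 2)) *: xi2 K n
      + \sum_(2 <= j < n.+1) coor j (f (x 2) (x 2)) *: psi K n j.
Proof.
move=> /ZL2_F1P[f1 f2 f3 f4] fx1.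
set al := coor 1 _.
have N1 : N (x 1) = 0 by rewrite shift_ebas.
have f12 : f (x 1) (x 2) = al *: x 1 + coor n (f (x 1) (x 2)) *: x n.
  pose u := f (x 1) (x 2) - al *: x 1.
  have un : coor n u = coor n (f (x 1) (x 2)).
    by rewrite linearB linearZ /= coor_ebas (_ : (_ == _) = false) ?scaler0 ?subr0 //; lia.
  rewrite -un -shift_ker ?subrKC //.
    by rewrite linearB linearZ /= coor_ebas (leq_trans _ n_ge3) // [_ *: _]mulr1 subrr.
  by rewrite linearB linearZ /= N1 f3 // N1 linear0 zero_lfunE !scaler0 !subr0.
(* By commutation with the shift up to a multiple of it, passing from x_{m+2} to
   x_{m+3} shifts the value and adds al times x_{m+3}. *)
have fi2 m : f (x m.+2) (x 2) =
    m%:R *: (al *: x m.+2) + \sum_(2 <= j < n.+1) coor j (f (x 2) (x 2)) *: x (j + m)%N.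
  elim: m => [|m IHm].
    rewrite scale0r add0r; under eq_bigr do rewrite addn0.
    by rewrite -sum_coor_ker1 ?f2.
  have := f3 2%N m.+2 isT; rewrite shift_ebas // => /eqP; rewrite eq_sym subr_eq => /eqP ->.
  rewrite IHm linearD !linearZ /= shift_ebas // linear_sum addrAC -/al.
  rewrite -natr1 scalerDl scale1r; congr (_ + _).
    by rewrite /= scalerDr !scalerA mulrC.
  rewrite !big_nat; apply: eq_bigr => j lej.
  by rewrite linearZ /= shift_ebas // ifT ?addnS //; lia.
apply: bilmapP => i l lei lel.
rewrite !(add_lfunE, scale_lfunE) xi1_ebas // xi2_ebas // sum_psi_ebas //.
have [->|[->|l3]] : l = 1%N \/ l = 2%N \/ (3 <= l)%N by lia.
- by rewrite /= !andbF fx1 !scaler0 !addr0.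
- case: i lei => [|[|i]] // _ /=; first by rewrite addr0 -f12.
  rewrite (fi2 i) subSS subSS subn0 scaler0 addr0 !scalerA mulrC; congr (_ + _).
  by apply: eq_bigr => j _; congr (_ *: x _); lia.
have l2 : (l == 2)%N = false by lia.
case: l l3 l2 {lel} => // l l3 l2; rewrite l2 !andbF !scaler0 !addr0 f4 //.
rewrite fx1 linear0 addr0 shift_ebas // eqSS.
have [->|l4] := eqVneq l 2%N.
  by rewrite -/al andbT; case: ifP => _; rewrite ?scaler0 // scaleNr scalerN.
have -> : coor 1 (f (x 1) (x l)) = 0.
  by case: l l3 l4 {l2} => // l l3 l4; rewrite f4 ?N1 ?scaler0 ?linear0 //; lia.
by rewrite oppr0 scale0r andbF scaler0.
Qed.

(** * Spanning and independence *)

Definition basic_cocycles : seq (bilmap V) :=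
  [:: psi K n 2; xi1 K n; xi2 K n; phi K n 1 2]
    ++ [seq phi K n n k | k <- index_iota 2 n.+1]
    ++ [seq psi K n j | j <- index_iota 4 n.+1].

Lemma basic_cocyclesZ : {subset basic_cocycles <= ZL2 F}.
Proof.
move=> f; rewrite !mem_cat => /or3P[|/mapP[k]|/mapP[j]]; rewrite ?mem_index_iota.
- rewrite !inE => /or4P[] /eqP ->; first by apply: psi_cocycle => //; lia.
  + exact: xi1_cocycle.
  + exact: xi2_cocycle.
  + by apply: phi_cocycle => //; lia.
- by move=> lek ->; apply: phi_cocycle => //; lia.
by move=> lej ->; apply: psi_cocycle => //; lia.
Qed.

Lemma ZL2_sub_basic : (ZL2 F <= <<basic_cocycles>> + BL2 F)%VS.
Proof.
apply/subvP=> f fZ; have [g [a [v [gB h0]]]] := cocycle_normalize fZ.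
set W := (_ + _)%VS.
have BW b : b \in BL2 F -> b \in W := subvP (addvSr _ _) b.
have sW b : b \in basic_cocycles -> b \in W.
  by move=> /memv_span; apply: (subvP (addvSl _ _)).
have mem_basic i : (i < 4)%N -> basic_cocycles`_i \in basic_cocycles.
  by move=> lti; rewrite mem_nth // size_cat (leq_trans lti) ?leq_addr.
have phiW k : (2 <= k < n.+1)%N -> phi K n n k \in W.
  move=> lek; apply: sW; rewrite !mem_cat orbC -orbA orbC -orbA.
  by rewrite map_f ?orbT // mem_index_iota.
have psiW j : (2 <= j < n.+1)%N -> psi K n j \in W.
  move=> lej; have [->|[->|j4]] : j = 2%N \/ j = 3%N \/ (4 <= j)%N by lia.
  - by apply: sW; rewrite inE eqxx.
  - exact/BW/psi3_coboundary.
  by apply: sW; rewrite !mem_cat map_f ?orbT // mem_index_iota; lia.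
set c := g + a *: _ + _ in h0.
have cW : c \in W.
  rewrite rpredD ?(rpredD (BW g gB)) ?rpredZ ?(sW _ (mem_basic 3%N isT)) //.
  by rewrite big_nat rpred_sum // => k lek; rewrite rpredZ ?phiW.
have hZ : f - c \in ZL2 F.
  rewrite rpredB // !rpredD ?rpredZ ?phi_cocycle //; try lia.
    exact: (subvP (BL2_sub_ZL2 (@F1_leibniz K n))).
  by rewrite big_nat rpred_sum // => k lek; rewrite rpredZ // phi_cocycle //; lia.
rewrite -(subrK c f) rpredD // (cocycle_vanishing_at_x1 hZ h0).
rewrite !rpredD ?rpredZ ?(sW _ (mem_basic 1%N isT)) ?(sW _ (mem_basic 2%N isT)) //.
by rewrite big_nat rpred_sum // => j lej; rewrite rpredZ ?psiW.
Qed.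

Lemma coor_sum_ebas m (p : nat -> K) i : (1 <= m)%N ->
  coor i (\sum_(m <= j < n.+1) p j *: x j) = if (m <= i <= n)%N then p i else 0.
Proof.
move=> m1; rewrite linear_sum /=; case: ifP => lei; last first.
  rewrite big_nat big1 // => j lej; rewrite linearZ /= coor_ebas.
  by rewrite (_ : _ && _ = false) ?scaler0 //; lia.
rewrite (bigD1_seq i) ?iota_uniq ?mem_index_iota //=.
rewrite linearZ /= coor_ebas eqxx (_ : (1 <= i <= n)%N) /=; last by lia.
rewrite [_ *: _]mulr1 big1 ?addr0 // => j ji.
by rewrite linearZ /= coor_ebas eq_sym (negPf ji) scaler0.
Qed.

(** The first iterate already kills the coordinates of x_1 and x_2, and each
    further one kills one more: this is the nilpotency of the shift. *)
Lemma coor_iter_shift m i u : (1 <= m)%N -> (i <= m.+1)%N -> coor i (iter m N u) = 0.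
Proof.
elim: m i => // m IHm [|i] _ lei; first by rewrite coor_out.
rewrite iterS coor_shift //; case: ifP => // /andP[i2 _].
by rewrite IHm //; lia.
Qed.

Lemma basic_indep c0 c1 c2 c3 (p q : nat -> K) :
  c0 *: psi K n 2 + c1 *: xi1 K n + c2 *: xi2 K n + c3 *: phi K n 1 2
    + \sum_(2 <= k < n.+1) p k *: phi K n n k
    + \sum_(4 <= j < n.+1) q j *: psi K n j \in BL2 F ->
  [/\ c0 = 0, c1 = 0, c2 = 0 & c3 = 0]
  /\ (forall k, (2 <= k <= n)%N -> p k = 0) /\ (forall j, (4 <= j <= n)%N -> q j = 0).
Proof.
set f := (X in X \in _) => /BL2P[d fE].
have {}fE i j : f (x i) (x j) =
    (if j == 1%N then N (d (x i)) - d (N (x i)) else 0) + coor 1 (d (x j)) *: N (x i).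
  by rewrite fE -coboundaryE coboundary_F1.
have {}fE i l :
    c0 *: (if (2 <= i)%N && (l == 2)%N then x (2 + i - 2)%N else 0)
    + c1 *: xi1 K n (x i) (x l)
    + c2 *: (if (i == 1)%N && (l == 2)%N then x n else 0)
    + c3 *: (if (i == 1)%N && (l == 1)%N then x 2 else 0)
    + (if (i == n)%N && (l == 1)%N then \sum_(2 <= k < n.+1) p k *: x k else 0)
    + (if (2 <= i)%N && (l == 2)%N then \sum_(4 <= j < n.+1) q j *: x (j + i - 2)%N else 0)
  = (if l == 1%N then N (d (x i)) - d (N (x i)) else 0) + coor 1 (d (x l)) *: N (x i).
  rewrite -fE /f !(add_lfunE, scale_lfunE) sum_phi_ebas // sum_psi_ebas //.
  by rewrite psi_ebas // xi2_ebas // phi_ebas // (ltnW (ltnW n_ge3)).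
clear f.
have N1 : N (x 1) = 0 by rewrite shift_ebas.
have n1 : (1 <= n)%N by lia.
have n2 : (2 <= n)%N by lia.
have [n1F n2F] : (1 == n)%N = false /\ (2 == n)%N = false by split; lia.
have f12 : c1 *: x 1 + c2 *: x n = 0.
  have := fE 1%N 2%N.
  by rewrite /= n1F xi1_ebas // N1 !scaler0 !addr0 add0r.
have f11 : c3 *: x 2 = N (d (x 1)).
  have := fE 1%N 1%N.
  by rewrite /= n1F xi1_ebas // N1 [d 0]linear0 !scaler0 !addr0 !add0r subr0.
have f22 : c0 *: x 2 + \sum_(4 <= j < n.+1) q j *: x j = coor 1 (d (x 2)) *: x 3.
  have := fE 2%N 2%N.
  rewrite /= n2F xi1_ebas //= scale0r shift_ebas //= !scaler0 !addr0 add0r.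
  by under eq_bigr do rewrite addnK.
have coorE i j (c : K) : coor i (c *: x j) = c * ((i == j) && (1 <= i <= n)%N)%:R.
  by rewrite linearZ /= coor_ebas.
have c1_0 : c1 = 0.
  move: f12 => /(congr1 (coor 1)).
  by rewrite linearD /= !coorE n1F n1 mulr0 mulr1 addr0 linear0.
have c2_0 : c2 = 0.
  move: f12 => /(congr1 (coor n)).
  by rewrite c1_0 scale0r add0r coorE eqxx n1 leqnn mulr1 linear0.
have c3_0 : c3 = 0.
  by move: f11 => /(congr1 (coor 2)); rewrite coorE coor_shift // n2 mulr1.
have c0_0 : c0 = 0.
  move: f22 => /(congr1 (coor 2)).
  by rewrite linearD /= !coorE coor_sum_ebas // n2 mulr0 mulr1 addr0.
have q0 j : (4 <= j <= n)%N -> q j = 0.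
  move=> lej; move: f22 => /(congr1 (coor j)).
  rewrite linearD /= !coorE coor_sum_ebas // lej c0_0 mul0r add0r.
  by rewrite (_ : _ && _ = false) ?mulr0 //; lia.
have fi1 i : (2 <= i)%N ->
    (if i == n then \sum_(2 <= k < n.+1) p k *: x k else 0)
    = N (d (x i)) - d (x i.+1) + coor 1 (d (x 1)) *: x i.+1.
  move=> i2; have i1 : (i == 1)%N = false by lia.
  by have := fE i 1%N; rewrite /= xi1_ebas // i1 !andbF (andbT (i == n))
    shift_ebas // i2 !scaler0 !addr0 !add0r.
(* The x_1-component of the coboundary of d is zero at x_2, ..., x_{n-1}, which
   makes d commute with the shift up to a multiple of it. *)
have dE m : (m + 2 <= n)%N ->
    d (x m.+2) = iter m N (d (x 2)) + (m%:R * coor 1 (d (x 1))) *: x m.+2.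
  elim: m => [|m IHm] lem; first by rewrite mul0r scale0r addr0.
  have := fi1 m.+2 isT; rewrite (_ : (_ == n) = false) ?IHm; try lia.
  rewrite linearD linearZ /= shift_ebas //= => /esym/eqP.
  rewrite addrAC subr_eq0 => /eqP <-.
  by rewrite -addrA -scalerDl -natr1 mulrDl mul1r.
have p0 : \sum_(2 <= k < n.+1) p k *: x k = 0.
  have := fi1 n n2; rewrite eqxx => ->.
  rewrite (_ : x n.+1 = 0); last by rewrite ebas_out ?ltnn ?andbF.
  have n2E : (n - 2).+2 = n by lia.
  have := dE (n - 2)%N; rewrite n2E subnK // => -> //.
  rewrite [d 0]linear0 scaler0 addr0 subr0 linearD linearZ /= shift_ebas // n2.
  rewrite (_ : x n.+1 = 0) ?scaler0 ?addr0; last by rewrite ebas_out ?ltnn ?andbF.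
  by apply: coorP => i lei; rewrite linear0 -iterS coor_iter_shift //; lia.
split=> //; split=> // k lek.
by have := congr1 (coor k) p0; rewrite coor_sum_ebas // lek linear0.
Qed.

End AlgebraF1.

(** * The second cohomology space of F_n^1 *)

Theorem corollary3p5 (R : realType) (n : nat) (hn : (3 <= n)%N) :
  let C : fieldType := complex R in
  let F := F1 C n in
  let cocycles :=
    [:: psi C n 2; xi1 C n; xi2 C n; phi C n 1 2]
    ++ [seq phi C n n k | k <- index_iota 2 n.+1]
    ++ [seq psi C n j | j <- index_iota 4 n.+1] in
  [/\ forall f, f \in cocycles -> f \in ZL2 F,
      basis_of {: HL2 F}%VS [seq HL2class F f | f <- cocycles]
    & \dim {: HL2 F}%VS = (2 * n)%N].
Proof.
move=> C F cocycles.
have sZ : {subset cocycles <= ZL2 F} := basic_cocyclesZ hn.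
have basis : basis_of {: HL2 F}%VS [seq HL2class F f | f <- cocycles].
  apply: HL2_basis sZ (ZL2_sub_basic C hn) _; first exact: F1_leibniz.
  move=> k; rewrite /cocycles 2!sum_scale_cat !sum_scale_map_iota /= size_map size_iota.
  rewrite sum_nat_lt4 !addrA => /(basic_indep hn)[[k0 k1 k2 k3] [p0 q0]] i.
  rewrite size_cat !size_map !size_iota => lti.
  have [|[|[|[|[lei|lei]]]]] : i = 0%N \/ i = 1%N \/ i = 2%N \/ i = 3%N \/
      (4 <= i < n + 3)%N \/ (n + 3 <= i < 2 * n)%N by lia.
  1-4: by move=> ->.
  - by rewrite -(p0 (i - 2)%N); [congr k; lia | lia].
  by rewrite -(q0 (i - n + 1)%N); [congr k; lia | lia].
split=> //.
by rewrite (size_basis basis); lia.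
Qed.
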